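(* Let $k,r,n$ be integers with $4\leq r\leq k-1$ and $$n\geq 2(r+1)^r k\,\frac{\binom{2k-1}{k}}{\binom{2r-1}{r}}.$$ Then $$f(n,k,r)=|\mathcal{L}(n,k,r)|,$$ where $f(n,k,r)$ is the maximum size of an intersecting family $\mathcal{F}\subset\binom{[n]}{k}$ with $\delta_{k-1}^+(\mathcal{F})\geq r$, and $\mathcal{L}(n,k,r)=\left\{F\in\binom{[n]}{k}\colon |F\cap[2r-1]|\geq r\right\}$.
   Context: Here $[n]=\{1,2,\ldots,n\}$ and $\binom{[n]}{k}$ is the collection of all $k$-element subsets of $[n]$. A family $\mathcal{F}\subset\binom{[n]}{k}$ is intersecting if $F\cap F'\neq\emptyset$ for all $F,F'\in\mathcal{F}$. For $E\subset[n]$ let $\mathcal{F}(E)=\{F\setminus E\colon E\subset F\in\mathcal{F}\}$. The immediate shadow is $\partial\mathcal{F}=\left\{E\in\binom{[n]}{k-1}\colon E\subset F\text{ for some }F\in\mathcal{F}\right\}$. The shadow degree (minimum positive co-degree) is $\delta_{k-1}^+(\mathcal{F})=\min\{|\mathcal{F}(E)|\colon E\in\partial\mathcal{F}\}$; thus $\delta_{k-1}^+(\mathcal{F})\geq r$ means that every $E\in\partial\mathcal{F}$ is contained in at least $r$ members of $\mathcal{F}$. *)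

(* Defs.v *)
From HB Require Import structures.
From mathcomp Require Import all_boot all_order all_algebra.

Set Implicit Arguments.
Unset Strict Implicit.
Unset Printing Implicit Defensive.

(* The ground set [n] = {1, ..., n} is 'I_n = {0, ..., n-1}, with all indices
   shifted down by one; in particular [m] becomes {i : 'I_n | i < m}. *)

Section Families.
Variables n k : nat.
Implicit Types (FF : {set {set 'I_n}}) (E : {set 'I_n}).

Definition uniform_sets : {set {set 'I_n}} := [set F : {set 'I_n} | #|F| == k].

Definition intersecting FF : bool :=
  [forall F : {set 'I_n} in FF, forall F' : {set 'I_n} in FF, F :&: F' != set0].

Definition link FF E : {set {set 'I_n}} :=
  [set F :\: E | F : {set 'I_n} in FF & E \subset F].

Definition shadow FF : {set {set 'I_n}} :=
  [set E : {set 'I_n} | (#|E| == k.-1) && [exists F : {set 'I_n} in FF, E \subset F]].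

(* The default value n is neutral: for a k-uniform FF with k > 0 and
   #|E| = k - 1, link FF E consists of singletons, so it has at most n elements.
   It only matters for an empty shadow. *)
Definition shadow_degree FF : nat :=
  \big[minn/n]_(E in shadow FF) #|link FF E|.

Definition max_intersecting (r : nat) : nat :=
  \max_(FF : {set {set 'I_n}} | [&& FF \subset uniform_sets, intersecting FF
                                  & r <= shadow_degree FF]) #|FF|.

Definition initial_segment (m : nat) : {set 'I_n} := [set i : 'I_n | i < m].

Definition majority_family (r : nat) : {set {set 'I_n}} :=
  [set F : {set 'I_n} in uniform_sets | r <= #|F :&: initial_segment (2 * r - 1)|].

End Families.

(* Main.v *)
Require Import Defs.
From HB Require Import structures.
From mathcomp Require Import all_boot all_order all_algebra.
From mathcomp Require Import zify ring.
Import Order.TTheory GRing.Theory Num.Theory.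

(** Let FF be k-uniform and intersecting with shadow degree at least r. Replacing
one element x of a member F by another element is possible in at least r ways
([exchange]). Everything below exploits this exchange property.

If D meets every member of FF, take a member F with |D :&: F| minimal and remove
from F an element x of D :&: F: by minimality every element y that restores
F :\ x to a member of FF lies in D. Hence |D| >= r, and if |D| = r then
D :&: F = [set x] and the r restoring elements are exactly those of D
([hitting_exchange], [tight_hitting]). Call D tight in that case.

This already settles the r-uniform case: a nonempty r-uniform intersecting family
with the exchange property contains all r-subsets of some (2r-1)-set, because two
members sharing a single element can be moved around by exchanges until one of
them is any prescribed r-subset of their union ([exchange_complete]).

For general k, let QQ be a minimal subfamily of FF that detects, among the sets of
size at most r, those that miss some member of FF, and let V be its union. By
Bollobas's set-pair inequality |QQ| <= 'C(k + r, k), so V has size independent of n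
([kernel]). Each trace F :&: V meets all of QQ; therefore it has at least r
elements, and if it has exactly r then it meets all of FF. Consequently the traces
of size r form an intersecting family that inherits the exchange property
([tight_traces_complete]).

- If there is a trace of size r, the r-uniform case supplies a (2r-1)-set S all of
  whose r-subsets meet all of FF. Then every F in FF has at least r elements in S,
  so FF is at most as large as the majority family.
- Otherwise all traces have more than r elements. Then FF is too small: a member
  either contains no tight set, and a branching argument pins down r + 1 of its
  elements in k ^ r.+1 ways; or it contains a tight set and one more element of V,
  and the number of tight sets is at most 'C(r + k.-1, r), again by Bollobas
  ([card_no_tight_trace]). So |FF| is at most a constant times
  'C(n - r.+1, k - r.+1), while the majority family has at least
  'C(2r-1, r) * 'C(n - (2r-1), k - r) members, which is larger for n above the
  stated bound ([loose_families_small]). *)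

(** * Exchanging elements and hitting sets *)

Definition extension {T : finType} (FF : {set {set T}}) (E : {set T}) : {set T} :=
  [set y | (y \notin E) && (y |: E \in FF)].

(** Lower bound r on the positive codegree: the shadow of a k-uniform FF
consists of the sets F :\ x, so quantifying over F and x avoids mentioning k. *)
Definition exchange {T : finType} (r : nat) (FF : {set {set T}}) : Prop :=
  forall F x, F \in FF -> x \in F -> r <= #|extension FF (F :\ x)|.

Definition hitting {T : finType} (FF : {set {set T}}) (D : {set T}) : bool :=
  [forall F in FF, D :&: F != set0].

Lemma hittingP {T : finType} (FF : {set {set T}}) (D : {set T}) :
  reflect (forall F, F \in FF -> exists2 x, x \in D & x \in F) (hitting FF D).
Proof.
apply: (iffP forall_inP) => h F /h.
  by case/set0Pn=> x /setIP[xD xF]; exists x.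
by case=> x xD xF; apply/set0Pn; exists x; rewrite inE xD.
Qed.

(** Take F with |D :&: F| minimal: an element y outside D that restores F :\ x
would give a member meeting D in fewer elements. So all r choices of y lie in D,
outside F :\ x. *)
Lemma hitting_exchange {T : finType} r (FF : {set {set T}}) (D : {set T}) :
  FF != set0 -> exchange r FF -> hitting FF D ->
  exists F x, [/\ F \in FF, x \in D :&: F, r + #|D :&: F| <= #|D|.+1
    & extension FF (F :\ x) \subset D :\: (F :\ x)].
Proof.
case/set0Pn=> F0 F0F ex /hittingP tr.
case: (arg_minnP (fun F : {set T} => #|D :&: F|) F0F) => F FF_F minF.
have [x xD xF] := tr _ FF_F.
have sub : extension FF (F :\ x) \subset D :\: (F :\ x).
  apply/subsetP=> y; rewrite in_set => /andP[yF yFF].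
  rewrite in_setD yF /=; apply: contraT => yD.
  have := minF _ yFF; rewrite leqNgt => /negP[]; apply: proper_card.
  apply/properP; split.
    apply/subsetP=> z; rewrite !inE => /andP[zD /orP[/eqP zy|/andP[_ zF]]].
      by rewrite zy (negbTE yD) in zD.
    by rewrite zD.
  exists x; first by rewrite inE xD.
  by rewrite !inE eqxx xD /= orbF; apply/negP=> /eqP xy; rewrite -xy xD in yD.
exists F, x; split=> //; first by rewrite inE xD.
have := leq_trans (ex _ _ FF_F xF) (subset_leq_card sub).
rewrite cardsD setIDA.
have := cardsD1 x (D :&: F); rewrite !inE xD xF /=.
have := subset_leq_card (subsetIl D F).
lia.
Qed.

Lemma hitting_size {T : finType} r (FF : {set {set T}}) (D : {set T}) :
  FF != set0 -> exchange r FF -> hitting FF D -> r <= #|D|.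
Proof.
move=> F0 ex tr; have [F [x [_ xDF le _]]] := hitting_exchange _ _ _ F0 ex tr.
have : 0 < #|D :&: F| by apply/card_gt0P; exists x.
lia.
Qed.

(** For |D| = r the count in [hitting_exchange] is tight, so every element of D,
and no other, restores F :\ x. *)
Lemma tight_hitting {T : finType} r (FF : {set {set T}}) (D : {set T}) :
  FF != set0 -> exchange r FF -> hitting FF D -> #|D| = r ->
  exists F x, [/\ F \in FF, D :&: F = [set x] & extension FF (F :\ x) = D].
Proof.
move=> F0 ex tr Dr; have [F [x [FF_F xDF le sub]]] := hitting_exchange _ _ _ F0 ex tr.
have DF : D :&: F = [set x].
  apply/esym/eqP; rewrite eqEcard sub1set xDF cards1; lia.
exists F, x; split=> //; apply/eqP; rewrite eqEcard (subset_trans sub (subsetDl _ _)) Dr /=.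
by apply: ex => //; move: xDF; rewrite inE => /andP[].
Qed.

(** * The uniformity-r case *)

(** B :\ x is disjoint from C, while every member meets C, so a restoring element
must lie in C; there are at least r = |C| of them. *)
Lemma disjoint_extension {T : finType} r (BB : {set {set T}}) (B C : {set T}) x :
  exchange r BB -> hitting BB C -> #|C| = r ->
  B \in BB -> B :&: C = [set x] -> extension BB (B :\ x) = C.
Proof.
move=> ex /hittingP tr Cr BBB BC.
have /setIP[xB xC] : x \in B :&: C by rewrite BC set11.
apply/eqP; rewrite eqEcard Cr ex // andbT.
apply/subsetP=> y; rewrite in_set => /andP[yB yBB].
have [z zC] := tr _ yBB; rewrite !inE => /orP[/eqP<- //|/andP[zx zB]].
have : z \in B :&: C by rewrite inE zB.
by rewrite BC inE (negbTE zx).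
Qed.

(** Start from two members B0 and C0 sharing one element, and let S be their
union. To bring B0 closer to a given r-subset R of S, trade p in B0 :\: R
for q in R :\: B0: first replace the common element in C0 by p, so that p
becomes the common element, then replace p in B0 by q. Both moves are instances
of [disjoint_extension], and they preserve the union S. *)
Lemma exchange_complete {T : finType} r (BB : {set {set T}}) :
  BB != set0 -> {in BB, forall B : {set T}, #|B| = r} ->
  {in BB, forall B, hitting BB B} -> exchange r BB ->
  exists2 S : {set T}, #|S| = (2 * r).-1 &
    forall R : {set T}, R \subset S -> #|R| = r -> R \in BB.
Proof.
move=> BB0 unif int ex; have [B0 B0B] := set0Pn _ BB0.
have [C0 [x0 [C0B BC0 _]]] := tight_hitting _ _ _ BB0 ex (int _ B0B) (unif _ B0B).
exists (B0 :|: C0).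
  by rewrite cardsU BC0 cards1 !unif //; lia.
move eqS: (B0 :|: C0) => S R RS Rr.
have [m] := ubnP #|R :\: B0|; elim: m => // m IH in B0 C0 x0 B0B C0B BC0 eqS *.
move=> lem; have [RB|] := eqVneq (R :\: B0) set0.
  suff -> : R = B0 by [].
  by apply/eqP; rewrite eqEcard -setD_eq0 RB eqxx Rr unif /=.
case/set0Pn=> q /setDP[qR qB].
have qC : q \in C0.
  by have := subsetP RS _ qR; rewrite -eqS inE (negbTE qB).
have [p] : exists p, p \in B0 :\: R.
  apply/set0Pn; rewrite setD_eq0; apply/negP=> BR.
  have /eqP RB : B0 == R by rewrite eqEcard BR Rr unif /=.
  by rewrite RB qR in qB.
case/setDP=> pB pR.
have inter z : (z \in B0) && (z \in C0) = (z == x0).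
  by rewrite -in_setI BC0 inE.
have BCx : B0 :&: C0 = C0 :&: B0 by rewrite setIC.
(* Make p the common element. *)
have C1B : p |: (C0 :\ x0) \in BB.
  have := disjoint_extension _ _ C0 B0 x0 ex (int _ B0B) (unif _ B0B) C0B.
  by rewrite -BCx => /(_ BC0)/setP/(_ p); rewrite pB in_set => /andP[].
set C1 := p |: _ in C1B.
have BC1 : B0 :&: C1 = [set p].
  apply/setP=> z; rewrite !inE; have := inter z.
  case: (eqVneq z p) => [->|_] /=; first by rewrite pB.
  by case: (z \in B0); case: (z \in C0); case: (z == x0).
have qp : q != p by apply: contraNneq qB => ->.
have qx : q != x0.
  by have := inter q; rewrite (negbTE qB) /= => <-.
have qC1 : q \in C1 by rewrite !inE qC qx orbT.
(* Now p can be traded for q. *)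
have B1B : q |: (B0 :\ p) \in BB.
  have := disjoint_extension _ _ B0 C1 p ex (int _ C1B) (unif _ C1B) B0B BC1.
  by move/setP/(_ q); rewrite qC1 in_set => /andP[].
apply: (IH (q |: (B0 :\ p)) C1 q) => //.
- apply/setP=> z; have/setP/(_ z) := BC1; rewrite !inE.
  case: (eqVneq z q) => [->|_] /=; first by rewrite qC qx orbT.
  by case: (z == p); case: (z \in B0); case: (z \in C0); case: (z == x0).
- rewrite -eqS; apply/setP=> z; have := inter z; rewrite !inE.
  case: (eqVneq z q) => [->|_] /=; first by rewrite qC orbT.
  case: (eqVneq z p) => [->|_] /=; first by rewrite pB.
  by case: (z \in B0); case: (z \in C0); case: (z == x0).
- rewrite -ltnS; apply: leq_trans lem; rewrite ltnS; apply: proper_card.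
  apply/properP; split; last by exists q; rewrite !inE ?qR ?qB // eqxx.
  apply/subsetP=> z; rewrite !inE negb_or => /andP[/andP[zq zB] zR].
  rewrite zR andbT; apply: contra zB => zB; rewrite zB andbT.
  by apply: contraNneq pR => <-.
Qed.

(** * Bollobas's set-pair inequality *)

(** The averaging identity behind Bollobas's inequality: delete a uniformly random
point x of W from the pair (A, B), counting the pair as lost if x lies in A; then
the expected weight of what remains is the weight of (A, B). *)
Lemma sum_inv_bin {T : finType} (W A B : {set T}) :
  A \subset W -> B \subset W -> [disjoint A & B] -> B != set0 ->
  (\sum_(x in W :\: A) ('C(#|A| + #|B :\ x|, #|A|)%:R)^-1
    = #|W|%:R / 'C(#|A| + #|B|, #|A|)%:R :> rat)%R.
Proof.
move=> AW BW dAB B0.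
have BWA : B \subset W :\: A by rewrite subsetD BW disjoint_sym.
rewrite (big_setID B) /= (setIidPr BWA).
have [b eb] : exists b, #|B| = b.+1.
  by exists #|B|.-1; rewrite prednK // card_gt0.
rewrite (eq_bigr (fun=> ('C(#|A| + b, #|A|)%:R)^-1)%R); last first.
  by move=> x xB; have := cardsD1 x B; rewrite xB eb add1n => -[<-].
rewrite sumr_const eb.
rewrite (eq_bigr (fun=> ('C(#|A| + b.+1, #|A|)%:R)^-1)%R); last first.
  move=> x /setDP[_ xB]; suff -> : B :\ x = B by rewrite eb.
  by apply/setDidPl; rewrite disjoint_sym disjoints1.
rewrite sumr_const.
have cW : #|W| = #|A| + b.+1 + #|W :\: A :\: B|.
  have := cardsID A W; have := cardsID B (W :\: A).
  by rewrite (setIidPr AW) (setIidPr BWA) -eb -addnA => -> ->.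
have := mul_bin_down (#|A| + b.+1) #|A|.
rewrite addnS /= -addnS addKn => eC.
have C1 : ('C(#|A| + b, #|A|)%:R != 0 :> rat)%R by rewrite pnatr_eq0 -lt0n bin_gt0 leq_addr.
have C2 : ('C(#|A| + b.+1, #|A|)%:R != 0 :> rat)%R by rewrite pnatr_eq0 -lt0n bin_gt0 leq_addr.
rewrite cW [in RHS]natrD mulrDl.
rewrite -[X in (X + _)%R = _]mulr_natl -[X in (_ + X)%R = _]mulr_natl.
congr (_ + _)%R.
apply: (mulIf C1); apply: (mulIf C2); rewrite divfK // mulrAC divfK //.
by rewrite -!natrM eC.
Qed.

(** Induction on the ground set W: for each point x of W, the pairs with x outside
A i remain cross-intersecting after x is deleted from the B i, so their weights
sum to at most 1. Summing over x and using [sum_inv_bin] for each pair gives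
|W| times the total weight on one side and |W| on the other. *)
Lemma bollobas_weighted {I T : finType} (a : nat) (W : {set T}) (J : {set I})
    (A B : I -> {set T}) :
  {in J, forall i, [/\ A i \subset W, B i \subset W, #|A i| = a & [disjoint A i & B i]]} ->
  {in J &, forall i j, i != j -> ~~ [disjoint A i & B j]} ->
  (\sum_(i in J) ('C(a + #|B i|, a)%:R)^-1 <= 1 :> rat)%R.
Proof.
have [m] := ubnP #|W|; elim: m => // m IH in W J B *; rewrite ltnS => Wm hJ cross.
have [->|/set0Pn[i0 i0J]] := eqVneq J set0; first by rewrite big_set0.
(* An empty [B i] meets no [A j], so it can only occur in a one-element family. *)
have [i /andP[iJ /= /eqP Bi0]|Bn0] := pickP [pred i in J | B i == set0].
  have -> : J = [set i].
    apply/eqP; rewrite eqEsubset sub1set iJ andbT; apply/subsetP=> j jJ.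
    rewrite inE; apply: contraT => ji; have := cross _ _ jJ iJ ji.
    by rewrite Bi0 -setI_eq0 setI0 eqxx.
  by rewrite big_set1 Bi0 cards0 addn0 binn invr1.
have {}Bn0 i : i \in J -> B i != set0.
  by move=> iJ; have := Bn0 i; rewrite /= iJ /= => ->.
have W0 : (0 < #|W|%:R :> rat)%R.
  rewrite ltr0n card_gt0; have [_ BW _ _] := hJ _ i0J.
  by apply: contraNneq (Bn0 _ i0J) => W0; rewrite -subset0 -W0.
rewrite -(ler_pM2l W0) mulr1 mulr_sumr.
rewrite (eq_bigr (fun i => \sum_(x in W :\: A i) ('C(a + #|B i :\ x|, a)%:R)^-1)%R); last first.
  move=> i iJ; have [AW BW <- dAB] := hJ _ iJ.
  by rewrite sum_inv_bin // Bn0.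
rewrite (exchange_big_dep (mem W)) /=; last by move=> i x _ /setDP[].
rewrite -sumr_const; apply: ler_sum => x xW.
rewrite (eq_bigl (mem [set i in J | x \notin A i])); last first.
  by move=> i; rewrite !inE xW andbT.
apply: (IH (W :\ x)).
- by rewrite (cardsD1 x) xW add1n in Wm.
- move=> i; rewrite inE => /andP[iJ xA]; have [AW BW cA dAB] := hJ _ iJ; split=> //.
  + by rewrite subsetD1 AW.
  + exact: setSD.
  + by apply: disjointWr dAB; apply: subsetDl.
move=> i j; rewrite !inE => /andP[iJ xA] /andP[jJ _] ij.
have /pred0Pn[y /andP[/= yA yB]] := cross _ _ iJ jJ ij.
apply/pred0Pn; exists y; rewrite /= yA !inE yB andbT.
by apply: contraNneq xA => <-.
Qed.

Lemma bollobas {I T : finType} (a b : nat) (J : {set I}) (A B : I -> {set T}) :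
  {in J, forall i, [/\ #|A i| = a, #|B i| <= b & [disjoint A i & B i]]} ->
  {in J &, forall i j, i != j -> ~~ [disjoint A i & B j]} ->
  #|J| <= 'C(a + b, a).
Proof.
move=> hJ cross.
have pos c : (0 < 'C(a + c, a)%:R :> rat)%R by rewrite ltr0n bin_gt0 leq_addr.
have sum1 : (\sum_(i in J) ('C(a + #|B i|, a)%:R)^-1 <= 1 :> rat)%R.
  apply: (bollobas_weighted a setT J A B _ cross) => i iJ.
  by have [cA _ dAB] := hJ _ iJ; rewrite !subsetT.
rewrite -(ler_nat rat) -[leRHS]mul1r -ler_pdivrMr //; move: sum1; apply: le_trans.
rewrite mulr_natl -sumr_const; apply: ler_sum => i iJ.
have [_ Bb _] := hJ _ iJ.
by rewrite lef_pV2 ?posrE // ler_nat leq_bin2l // leq_add2l.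
Qed.

(** * Tight hitting sets and a kernel of bounded size *)

Definition tight_hitting_sets {T : finType} r (FF : {set {set T}}) : {set {set T}} :=
  [set D : {set T} | (#|D| == r) && hitting FF D].

(** To a tight D attach the set G = F :\ x of [tight_hitting], which is disjoint
from D and is completed to a member of FF by each element of D. Another tight
D' disjoint from G would have to contain every element of D, hence equal it. So
the pairs (D, G) satisfy Bollobas's condition. *)
Lemma card_tight_hitting_sets {T : finType} k r (FF : {set {set T}}) :
  FF != set0 -> {in FF, forall F : {set T}, #|F| = k} -> exchange r FF ->
  #|tight_hitting_sets r FF| <= 'C(r + k.-1, r).
Proof.
move=> FF0 unif ex.
have [G GP] : exists G : {set T} -> {set T}, forall D, D \in tight_hitting_sets r FF ->
    [/\ #|G D| = k.-1, [disjoint D & G D] & extension FF (G D) = D].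
  apply: (@fin_all_exists _ (fun=> {set T}) (fun D G => D \in tight_hitting_sets r FF ->
    [/\ #|G| = k.-1, [disjoint D & G] & extension FF G = D])) => D.
  have [|DT] := boolP (D \in _); last by exists set0.
  rewrite inE => /andP[/eqP Dr tr].
  have [F [x [FF_F DF eF]]] := tight_hitting _ _ _ FF0 ex tr Dr.
  have xF : x \in F by have /setP/(_ x) := DF; rewrite !inE eqxx => /andP[].
  exists (F :\ x) => _; split=> //.
    by have := cardsD1 x F; rewrite xF unif // => ->.
  by rewrite -setI_eq0 setIDA DF setDv.
apply: (bollobas _ _ _ id G) => [D DT|D D' DT DT' DD'].
  have [-> dis _] := GP _ DT; split=> //.
  by move: DT; rewrite inE => /andP[/eqP].
apply: contra_neqN DD' => dis.
move: (DT) (DT'); rewrite !inE => /andP[/eqP Dr /hittingP tr] /andP[/eqP Dr' _].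
apply/esym/eqP; rewrite eqEcard Dr Dr' leqnn andbT.
have [_ _ eD'] := GP _ DT'.
apply/subsetP=> y; rewrite -{1}eD' inE => /andP[_ /tr[z zD]].
rewrite !inE => /orP[/eqP<- //|zG].
by rewrite (disjointFr dis zD) in zG.
Qed.

(** A minimal QQ is critical: each Q in it has a set D of size at most r that is
disjoint from Q and meets all other members of QQ. Bollobas's inequality bounds
the number of such pairs. *)
Lemma small_witness {T : finType} k r (FF : {set {set T}}) :
  {in FF, forall F : {set T}, #|F| = k} ->
  exists QQ : {set {set T}}, [/\ QQ \subset FF, #|QQ| <= 'C(k + r, k) &
    forall D : {set T}, #|D| <= r -> hitting QQ D -> hitting FF D].
Proof.
move=> unif.
pose P (QQ : {set {set T}}) :=
  [forall D : {set T}, (#|D| <= r) && hitting QQ D ==> hitting FF D].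
have PFF : P FF by apply/forallP=> D; apply/implyP=> /andP[].
have [QQ /minsetP[PQ minQ] QF] := minset_exists PFF.
exists QQ; split=> //; last first.
  by move=> D Dr tr; move/forallP/(_ D): PQ; rewrite Dr tr.
have [G GP] : exists G : {set T} -> {set T}, forall Q, Q \in QQ ->
    [/\ #|G Q| <= r, hitting (QQ :\ Q) (G Q) & ~~ hitting QQ (G Q)].
  apply: (@fin_all_exists _ (fun=> {set T}) (fun Q D => Q \in QQ ->
    [/\ #|D| <= r, hitting (QQ :\ Q) D & ~~ hitting QQ D])) => Q.
  have [QQ_Q|_] := boolP (Q \in _); last by exists set0.
  have : ~~ P (QQ :\ Q).
    apply/negP=> /minQ/(_ (subsetDl _ _))/setP/(_ Q).
    by rewrite !inE eqxx QQ_Q.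
  case/forallPn=> D; rewrite negb_imply => /andP[/andP[Dr tr] ntr].
  exists D => _; split=> //; apply: contra ntr => tr'.
  by move/forallP/(_ D): PQ; rewrite Dr tr'.
apply: (bollobas _ _ _ id G) => [Q QQ_Q|Q Q' QQ_Q QQ_Q' QQ'].
  have [Gr /forall_inP tr /forall_inPn[Q' QQ_Q' dis]] := GP _ QQ_Q; split=> //.
    by apply: unif; apply: (subsetP QF).
  rewrite negbK in dis; rewrite disjoint_sym -setI_eq0.
  have [eQ|QQ'] := eqVneq Q' Q; first by rewrite -[X in _ :&: X]eQ.
  by have := tr Q'; rewrite in_setD1 QQ' QQ_Q' (eqP dis) eqxx => /(_ isT).
have [_ /forall_inP/(_ Q) + _] := GP _ QQ_Q'.
by rewrite in_setD1 QQ' QQ_Q -setI_eq0 setIC => /(_ isT).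
Qed.

(** V is the union of the witnesses. Restricting F to V loses none of its
intersections with the witnesses, so F :&: V still meets all of them. *)
Lemma kernel {T : finType} k r (FF : {set {set T}}) :
  {in FF, forall F : {set T}, #|F| = k} -> {in FF, forall F, hitting FF F} ->
  exists V : {set T}, #|V| <= k * 'C(k + r, k) /\
    {in FF, forall F, #|F :&: V| <= r -> hitting FF (F :&: V)}.
Proof.
move=> unif int; have [QQ [QF cQ wit]] := small_witness k r FF unif.
exists (cover QQ); split.
  apply: leq_trans (leq_card_cover _) _; rewrite mulnC.
  apply: leq_trans (_ : #|QQ| * k <= _); last by rewrite leq_mul2r cQ orbT.
  by rewrite -sum_nat_const; apply: leq_sum => Q /(subsetP QF)/unif->.
move=> F FF_F /wit; apply; apply/forall_inP=> Q QQ_Q.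
rewrite -setIA (setIidPr (bigcup_sup Q QQ_Q)).
by move/forall_inP: (int _ FF_F); apply; apply: (subsetP QF).
Qed.

Definition tight_traces {T : finType} r (FF : {set {set T}}) (V : {set T}) : {set {set T}} :=
  [set F :&: V | F : {set T} in FF & #|F :&: V| == r].

(** An r-element trace F :&: V meets every member of FF, and since it is contained
in V it meets every trace. If y restores F :\ x, the new trace is too large to
consist only of the r - 1 remaining elements of F :&: V, so y lies in V and the
new trace has size r as well. Hence [exchange_complete] applies to the traces. A
member with fewer than r elements in S would be disjoint from some r-subset of
S, yet such a subset is a trace and meets it. *)
Lemma tight_traces_complete {T : finType} r (FF : {set {set T}}) (V : {set T}) :
  exchange r FF ->
  {in FF, forall F, #|F :&: V| <= r -> hitting FF (F :&: V)} ->
  tight_traces r FF V != set0 ->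
  exists2 S : {set T}, #|S| = (2 * r).-1 &
    {in FF, forall F : {set T}, r <= #|F :&: S|}.
Proof.
move=> ex kerV BB0.
have tr B : B \in tight_traces r FF V -> hitting FF B.
  by case/imsetP=> F /setIdP[FF_F /eqP Fr] ->; apply: kerV; rewrite ?Fr.
have FF0 : FF != set0.
  by case/set0Pn: BB0 => B /imsetP[F /setIdP[FF_F _] _]; apply/set0Pn; exists F.
have big F : F \in FF -> r <= #|F :&: V|.
  move=> FF_F; have [Fr|/ltnW //] := leqP #|F :&: V| r.
  by apply: (hitting_size r FF) => //; apply: kerV.
have BV B : B \in tight_traces r FF V -> B \subset V.
  by case/imsetP=> F _ ->; apply: subsetIr.
have [|||S Sr complete] := exchange_complete r (tight_traces r FF V) BB0.
- by move=> B /imsetP[F /setIdP[_ /eqP Fr] ->].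
- move=> B BB; apply/hittingP=> _ /imsetP[F /setIdP[FF_F _] ->].
  have [x xB xF] := hittingP _ _ (tr _ BB) _ FF_F.
  by exists x; rewrite // inE xF (subsetP (BV _ BB)).
- move=> _ x /imsetP[F /setIdP[FF_F /eqP Fr] ->] /setIP[xF xV].
  apply: leq_trans (ex _ _ FF_F xF) (subset_leq_card _).
  apply/subsetP=> y; rewrite in_set => /andP[yF yFF].
  have yV : y \in V.
    apply: contraT => yV; have := big _ yFF; rewrite leqNgt => /negP[].
    rewrite -Fr; apply: proper_card; apply/properP; split.
      apply/subsetP=> z; rewrite !inE => /andP[/orP[/eqP->|/andP[_ ->] //]].
      by rewrite (negbTE yV).
    exists x; rewrite !inE ?xF // eqxx orbF xV andbT.
    by apply: contraNneq yV => <-.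
  have eqV : y |: (F :&: V) :\ x = (y |: F :\ x) :&: V.
    apply/setP=> z; rewrite !inE.
    by case: (eqVneq z y) => [->|]; rewrite ?yV //= andbA.
  rewrite in_set eqV; apply/andP; split.
    by apply: contra yF; rewrite !inE => /and3P[-> ->].
  apply/imsetP; exists (y |: F :\ x) => //; rewrite inE yFF -eqV cardsU1.
  have := cardsD1 x (F :&: V); rewrite Fr inE xF xV /= => eqr.
  suff -> : y \notin (F :&: V) :\ x by rewrite -eqr.
  by apply: contra yF; rewrite !inE => /and3P[-> ->].
exists S => // F FF_F; rewrite leqNgt; apply/negP=> ltr.
have : r <= #|S :\: F|.
  by have := cardsID F S; rewrite setIC Sr; lia.
rewrite -bin_gt0 -cards_draws card_gt0 => /set0Pn[R].
rewrite inE subsetD => /andP[/andP[RS RF] /eqP Rr].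
have /forall_inP/(_ _ FF_F) := tr _ (complete _ RS Rr).
by rewrite setI_eq0 RF.
Qed.

(** * Families all of whose traces are large *)

Lemma card_bigcup_le {I T : finType} (J : {set I}) (A : I -> {set T}) (c : nat) :
  {in J, forall i, #|A i| <= c} -> #|\bigcup_(i in J) A i| <= #|J| * c.
Proof.
move=> Ac; rewrite -sum_nat_const.
apply: (big_ind2 (fun (X : {set T}) m => #|X| <= m)) => [|X m Y m' Xm Ym|i /Ac //].
  by rewrite cards0.
by apply: leq_trans (leq_add Xm Ym); rewrite cardsU leq_subr.
Qed.

Lemma card_supersets {T : finType} k (D : {set T}) :
  #|[set F : {set T} | (D \subset F) && (#|F| == k)]| <= 'C(#|T| - #|D|, k - #|D|).
Proof.
have := cardsCs (~: D); rewrite setCK => <-.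
rewrite -cards_draws -(card_in_imset (f := fun F => F :\: D)).
  apply: subset_leq_card; apply/subsetP=> _ /imsetP[F + ->].
  rewrite !inE => /andP[DF /eqP <-].
  by rewrite setDE subsetIr -setDE cardsD (setIidPr DF) eqxx.
move=> F F'; rewrite !inE => /andP[DF _] /andP[DF' _] eqD.
by rewrite -(setID F D) -(setID F' D) (setIidPr DF) (setIidPr DF') eqD.
Qed.

(** While D has at most r elements it either is a tight set, so that no F counted
here contains it, or misses some F0 in FF. In the latter case F contains one of
the k elements of F0, which is added to D. *)
Lemma card_branching {T : finType} k r (FF : {set {set T}}) i (D : {set T}) :
  {in FF, forall F : {set T}, #|F| = k} -> {in FF, forall F, hitting FF F} ->
  (forall D, hitting FF D -> r <= #|D|) -> #|D| + i = r.+1 ->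
  #|[set F in FF | (D \subset F) &&
       [forall B in tight_hitting_sets r FF, ~~ (B \subset F)]]|
    <= k ^ i * 'C(#|T| - r.+1, k - r.+1).
Proof.
move=> unif int tau; elim: i D => [|i IH] D Dr.
  rewrite mul1n -Dr addn0; apply: leq_trans (card_supersets _ _).
  apply: subset_leq_card; apply/subsetP=> F; rewrite !inE => /and3P[/unif-> ->] _.
  by rewrite eqxx.
have [tr|/forall_inPn[F0 FF_F0]] := boolP (hitting FF D).
  have DT : D \in tight_hitting_sets r FF.
    by rewrite inE tr andbT; have := tau _ tr; lia.
  rewrite (_ : finset _ = set0) ?cards0 //; apply/setP=> F; rewrite !inE.
  apply/negP=> /and3P[_ DF /forall_inP/(_ _ DT)]; by rewrite DF.
rewrite negbK => /eqP DF0; rewrite expnS -mulnA -(unif _ FF_F0).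
apply: leq_trans (card_bigcup_le F0 (fun x => [set F in FF | (x |: D \subset F) &&
       [forall B in tight_hitting_sets r FF, ~~ (B \subset F)]]) _ _) => [|x xF0].
  apply: subset_leq_card; apply/subsetP=> F; rewrite inE => /and3P[FF_F DF noB].
  have [x xF xF0] := hittingP _ _ (int _ FF_F) _ FF_F0.
  by apply/bigcupP; exists x; rewrite // !inE FF_F noB subUset sub1set xF DF.
rewrite (unif _ FF_F0); apply: IH; rewrite cardsU1.
suff -> : x \notin D by rewrite /= -Dr; lia.
by apply/negP=> xD; have/setP/(_ x) := DF0; rewrite !inE xD xF0.
Qed.

(** A member that contains a tight set B has, besides the r elements of B, a
further element of V, because its trace has more than r elements. *)
Lemma card_no_tight_trace {T : finType} k r (FF : {set {set T}}) (V : {set T}) :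
  {in FF, forall F : {set T}, #|F| = k} -> {in FF, forall F, hitting FF F} ->
  (forall D, hitting FF D -> r <= #|D|) -> {in FF, forall F, r < #|F :&: V|} ->
  #|FF| <= (k ^ r.+1 + #|tight_hitting_sets r FF| * #|V|) * 'C(#|T| - r.+1, k - r.+1).
Proof.
move=> unif int tau big.
pose X := [set F in FF | (set0 \subset F) &&
       [forall B in tight_hitting_sets r FF, ~~ (B \subset F)]].
pose Y := \bigcup_(B in tight_hitting_sets r FF) \bigcup_(v in V :\: B)
   [set F : {set T} | (v |: B \subset F) && (#|F| == k)].
have XY : FF \subset X :|: Y.
  apply/subsetP=> F FF_F; rewrite !inE FF_F sub0set /=.
  case: (boolP [forall B in tight_hitting_sets r FF, ~~ (B \subset F)]) => //=.
  case/forall_inPn=> B BT; rewrite negbK => BF.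
  have [v] : exists v, v \in (F :&: V) :\: B.
    apply/set0Pn; rewrite setD_eq0; apply/negP=> /subset_leq_card.
    move: BT; rewrite inE => /andP[/eqP -> _].
    by rewrite leqNgt big.
  rewrite !inE => /and3P[vB vF vV].
  apply/bigcupP; exists B => //; apply/bigcupP; exists v; first by rewrite inE vB.
  by rewrite inE subUset sub1set vF BF unif //=.
apply: leq_trans (subset_leq_card XY) _.
apply: leq_trans (_ : #|X| + #|Y| <= _); first by rewrite cardsU leq_subr.
rewrite mulnDl; apply: leq_add; first by apply: card_branching; rewrite ?cards0.
rewrite -mulnA; apply: card_bigcup_le => B; rewrite inE => /andP[/eqP Br _].
apply: leq_trans (_ : #|V :\: B| * 'C(#|T| - r.+1, k - r.+1) <= _); last first.
  by rewrite leq_mul2r subset_leq_card ?orbT // subsetDl.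
apply: card_bigcup_le => v /setDP[_ vB].
have <- : #|v |: B| = r.+1 by rewrite cardsU1 vB Br.
exact: card_supersets.
Qed.

(** * Sets meeting a given set heavily *)

(** List S first and its complement afterwards, do the same with S', and match the
two lists position by position. *)
Lemma injection_onto {T : finType} (S S' : {set T}) :
  #|S| = #|S'| -> exists2 f : T -> T, injective f & f @: S = S'.
Proof.
move=> SS'.
pose s (A : {set T}) := enum A ++ enum (~: A).
have mem_s A x : x \in s A by rewrite mem_cat !mem_enum inE orbN.
have uniq_s A : uniq (s A).
  rewrite cat_uniq !enum_uniq andbT /=; apply/hasPn=> x.
  by rewrite !mem_enum inE.
have size_s A : size (s A) = #|T| by rewrite size_cat -!cardE cardsC.
have idx A x : index x (s A) < #|T| by rewrite -(size_s A) index_mem.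
pose f x := nth x (s S') (index x (s S)).
have fE x y : f x = nth y (s S') (index x (s S)) by apply: set_nth_default; rewrite size_s.
have finj : injective f.
  move=> x y; rewrite (fE x y) => /eqP; rewrite nth_uniq ?size_s // => /eqP eqi.
  by rewrite -(nth_index x (mem_s S x)) eqi nth_index.
exists f => //; apply/eqP; rewrite eqEcard card_imset // SS' leqnn andbT.
apply/subsetP=> _ /imsetP[x xS ->].
rewrite /f /s index_cat mem_enum xS nth_cat -cardE -SS' cardE.
have lt : index x (enum S) < size (enum S) by rewrite index_mem mem_enum.
by rewrite lt -mem_enum mem_nth // -cardE -SS' cardE.
Qed.

Lemma card_heavy_sets {T : finType} k r (S S' : {set T}) :
  #|S| = #|S'| ->
  #|[set F : {set T} | (#|F| == k) && (r <= #|F :&: S|)]|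
    <= #|[set F : {set T} | (#|F| == k) && (r <= #|F :&: S'|)]|.
Proof.
case/injection_onto=> f finj <-.
rewrite -(card_imset _ (imset_inj finj)); apply: subset_leq_card.
apply/subsetP=> _ /imsetP[F + ->]; rewrite !inE card_imset //.
by rewrite -imsetI ?card_imset //; apply: in2W.
Qed.

Lemma card_heavy_sets_ge {T : finType} k r (S : {set T}) :
  r <= k ->
  'C(#|S|, r) * 'C(#|T| - #|S|, k - r)
    <= #|[set F : {set T} | (#|F| == k) && (r <= #|F :&: S|)]|.
Proof.
move=> rk; have := cardsCs (~: S); rewrite setCK => <-.
rewrite -!cards_draws -cardsX.
rewrite -(card_in_imset (f := fun p => p.1 :|: p.2)); last first.
  have rec (A B : {set T}) : A \subset S -> B \subset ~: S ->
      A = (A :|: B) :&: S /\ B = (A :|: B) :\: S.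
    move=> AS BS; have /setIidPl AS' := AS; have /setIidPl BS' := BS.
    rewrite setIUl setDUl AS' setDE [B :\: S]setDE BS'.
    have -> : A :&: ~: S = set0 by apply/eqP; rewrite setI_eq0 -subsets_disjoint.
    have -> : B :&: S = set0 by apply/eqP; rewrite setI_eq0 disjoints_subset.
    by rewrite setU0 set0U.
  move=> [A B] [A' B'] /=; rewrite !inE /=.
  move=> /andP[/andP[AS _] /andP[BS _]] /andP[/andP[AS' _] /andP[BS' _]] eU.
  have [eA eB] := rec _ _ AS BS; have [eA' eB'] := rec _ _ AS' BS'.
  by congr pair; [rewrite eA eU -eA' | rewrite eB eU -eB'].
apply: subset_leq_card; apply/subsetP=> _ /imsetP[[A B] /= + ->].
rewrite !inE /= => /andP[/andP[AS /eqP Ar] /andP[BS /eqP Bk]].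
rewrite cardsU (_ : A :&: B = set0) ?cards0 ?Ar ?Bk ?subn0 ?subnKC ?eqxx //=.
  by rewrite -Ar; apply: subset_leq_card; rewrite subsetI AS subsetUl.
apply/eqP; rewrite setI_eq0 disjoints_subset; apply: subset_trans AS _.
by rewrite -setCS setCK in BS.
Qed.

(** * Numerical estimates *)

Lemma bin_odd_central m :
  m.+2 * 'C((2 * m).+3, m.+2) = 2 * (2 * m).+3 * 'C((2 * m).+1, m.+1).
Proof.
rewrite -mul_bin_diag /= binS mulnAC.
have -> : 'C((2 * m).+1, m) = 'C((2 * m).+1, m.+1).
  by rewrite -bin_sub; [congr 'C(_, _)|]; lia.
by rewrite mulnC mulnDl; lia.
Qed.

Lemma bin_even_central m :
  m.+1 * 'C((2 * m).+2, m.+1) = 2 * (2 * m).+1 * 'C(2 * m, m).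
Proof.
have e := mul_bin_down (2 * m).+1 m; have := mul_bin_diag (2 * m).+2 m.
rewrite /= => <-; have -> : (2 * m).+2 = 2 * m.+1 by lia.
move: e; rewrite /= (_ : (2 * m).+1 - m = m.+1); last lia.
by move=> e; rewrite -[2 * m.+1 * _]mulnA -e mulnA.
Qed.

Lemma leq_bin_odd_central r m : r <= m ->
  'C((2 * r).+1, r.+1) <= 'C((2 * m).+1, m.+1).
Proof.
move/subnK<-; elim: (m - r) => // d; set x := (d + r) => IH.
apply: leq_trans IH _; rewrite addSn -/x mulnS.
rewrite -(@leq_pmul2l x.+2) // bin_odd_central; apply: leq_mul => //; lia.
Qed.

(** With k = m + 1 the statement compares k 'C(k+r-1, r) 'C(k+r, r) with
'C(2k-1, k). It is an equality at k = r + 1, and from k to k + 1 the left side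
grows by the smaller factor, since (k+1) (k+r) (k+r+1) <= 2 k^2 (2k+1) for
r < k. *)
Lemma prod_bin_bound r m : r <= m ->
  m.+1 * 'C(m + r, r) * 'C(m.+1 + r, r)
    <= r.+1 * 'C(2 * r, r) * 'C((2 * m).+1, m.+1).
Proof.
move/subnK<-; elim: (m - r) => [|d IH].
  have e : 'C(r.+1 + r, r) = 'C((2 * r).+1, r.+1).
    by rewrite -bin_sub; [congr 'C(_, _)|]; lia.
  by rewrite add0n e addnn -mul2n.
have rx : r <= d + r by lia.
rewrite addSn [2 * _.+1]mulnS; move: (d + r) rx IH => {}m rm IH.
have ef : m.+1 * 'C(m.+1 + r, r) = (m.+1 + r) * 'C(m + r, r).
  by have := mul_bin_down (m.+1 + r) r; rewrite addnK.
have eg : m.+2 * 'C(m.+2 + r, r) = (m.+2 + r) * 'C(m.+1 + r, r).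
  by have := mul_bin_down (m.+2 + r) r; rewrite addnK.
have ec := bin_odd_central m.
rewrite -(@leq_pmul2l (m.+1 * m.+2)) //.
move: IH ef eg ec; rewrite !add2n.
move: 'C(m + r, r) 'C(m.+1 + r, r) 'C(m.+2 + r, r) 'C((2 * m).+1, m.+1) 'C((2 * m).+3, m.+2).
move: (r.+1 * 'C(2 * r, r)) => M f g h c c' IH ef eg ec.
have -> : m.+1 * m.+2 * (m.+2 * g * h) = m.+2 * (m.+1 * g) * (m.+2 * h) by ring.
have -> : m.+1 * m.+2 * (M * c') = M * m.+1 * (m.+2 * c') by ring.
rewrite ef eg ec.
apply: leq_trans (_ : (2 * m.+1 * (2 * m).+3) * (m.+1 * f * g) <= _); last first.
  have -> : M * m.+1 * (2 * (2 * m).+3 * c) = (2 * m.+1 * (2 * m).+3) * (M * c) by ring.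
  by rewrite leq_mul2l IH orbT.
have -> : m.+2 * ((m.+1 + r) * f) * ((m.+2 + r) * g)
  = (m.+2 * ((m.+1 + r) * (m.+2 + r))) * (f * g) by ring.
have -> : 2 * m.+1 * (2 * m).+3 * (m.+1 * f * g) = (2 * m.+1 * (2 * m).+3 * m.+1) * (f * g) by ring.
apply: leq_mul => //.
apply: leq_trans (_ : m.+2 * ((m.+1 + m) * (m.+2 + m)) <= _).
  by rewrite leq_mul2l; apply/orP; right; apply: leq_mul; rewrite leq_add2l.
nia.
Qed.

Lemma expS_bernoulli k j : j <= k.+1 -> k.+1 ^ j * (k.+1 - j) <= k.+1 * k ^ j.
Proof.
elim: j => [|j IH] jk; first by rewrite !expn0; lia.
have {IH} := IH (ltnW jk); rewrite !expnS.
move: (k.+1 ^ j) (k ^ j) => x y IH.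
apply: leq_trans (_ : k * (x * (k.+1 - j)) <= _).
  have : k.+1 * (k.+1 - j.+1) <= k * (k.+1 - j) by nia.
  by rewrite [k.+1 * x]mulnC -mulnA [k * (x * _)]mulnCA leq_mul2l => ->; rewrite orbT.
by rewrite [k.+1 * (k * y)]mulnCA leq_mul2l IH orbT.
Qed.

(** That is, (1 + 1/k)^j <= 4 - 2/(k+1), which is the growth factor of the central
binomial coefficient in [bin_odd_central]. Bernoulli's inequality for the whole
exponent is too weak, but it suffices for each of the two halves of j. *)
Lemma expS_step k j : j <= k -> k.+1 ^ j.+1 <= (4 * k + 2) * k ^ j.
Proof.
move=> jk; set a := j./2; set b := j - a.
have [ha hb] : a <= j /\ 2 * a <= j <= (2 * a).+1 by rewrite /a; split; lia.
have eA := expS_bernoulli k a ltac:(lia); have eB := expS_bernoulli k b ltac:(lia).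
have ej : j = a + b by rewrite /b; lia.
have P0 : 0 < (k.+1 - a) * (k.+1 - b) by rewrite muln_gt0; lia.
rewrite -(leq_pmul2l P0) expnS {1 2}ej !expnD.
have := leq_mul eA eB.
have : k.+1 * k.+1 * k.+1 <= (4 * k + 2) * ((k.+1 - a) * (k.+1 - b)).
  have : k.+2 <= 2 * (k.+1 - a) by lia.
  have : k.+1 <= 2 * (k.+1 - b) by lia.
  move: (k.+1 - a) (k.+1 - b) => u v hv hu.
  have : k.+2 * k.+1 <= 4 * (u * v).
    by apply: leq_trans (leq_mul hu hv) _; lia.
  nia.
move: ((k.+1 - a)) (k.+1 - b) (k.+1 ^ a) (k.+1 ^ b) (k ^ a) (k ^ b) => u v x y z w h1 h2.
apply: leq_trans (_ : k.+1 * (x * u * (y * v)) <= _); first by lia.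
apply: leq_trans (_ : k.+1 * (k.+1 * z * (k.+1 * w)) <= _).
  by rewrite leq_mul2l h2 orbT.
apply: leq_trans (_ : (k.+1 * k.+1 * k.+1) * (z * w) <= _); first by lia.
apply: leq_trans (leq_mul h1 (leqnn (z * w))) _; lia.
Qed.

(** Equality holds at m = r; [expS_step] bounds the growth of the left side by that
of the central binomial coefficient. *)
Lemma exp_bin_bound r m : r <= m ->
  m.+1 ^ r.+1 * 'C((2 * r).+1, r.+1) <= r.+1 ^ r.+1 * 'C((2 * m).+1, m.+1).
Proof.
move/subnK<-; elim: (m - r) => [//|d IH].
have rx : r <= d + r by lia.
rewrite addSn [2 * _.+1]mulnS; move: (d + r) rx IH => {}m rm IH.
rewrite -(@leq_pmul2l m.+2) // add2n.
have := expS_step m.+1 r.+1 rm; have := bin_odd_central m; rewrite [m.+2 ^ _.+2]expnS.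
move: (m.+2 ^ r.+1) (m.+1 ^ r.+1) (r.+1 ^ r.+1) 'C((2 * r).+1, r.+1)
  'C((2 * m).+1, m.+1) 'C((2 * m).+3, m.+2) IH => x y z c c1 c2 IH ec h.
have -> : m.+2 * (x * c) = (m.+2 * x) * c by ring.
have -> : m.+2 * (z * c2) = z * (m.+2 * c2) by ring.
rewrite ec; apply: leq_trans (_ : ((4 * m.+1 + 2) * y) * c <= _).
  by rewrite leq_mul2r h orbT.
have -> : (4 * m.+1 + 2) * y * c = (4 * m.+1 + 2) * (y * c) by ring.
have -> : z * (2 * (2 * m).+3 * c1) = (2 * (2 * m).+3) * (z * c1) by ring.
by apply: leq_mul; last exact: IH; lia.
Qed.

Lemma bin_odd_central_ge r : 4 <= r -> 4 * r.+1 <= 'C((2 * r).+1, r.+1).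
Proof.
move/subnK<-; elim: (r - 4) => [//|d IH].
rewrite addSn [2 * _.+1]mulnS; move: (d + 4) IH => m IH.
have := bin_odd_central m; rewrite add2n; nia.
Qed.

Lemma bin_even_central_le r : 4 <= r -> 4 * r.+1 * 'C(2 * r, r) <= 3 * r.+1 ^ r.
Proof.
move/subnK<-; elim: (r - 4) => [//|d].
have : 4 <= d + 4 by lia.
rewrite addSn [2 * _.+1]mulnS; move: (d + 4) => m m4 IH.
have := bin_even_central m; rewrite add2n.
have : m.+1 ^ m <= m.+2 ^ m by rewrite leq_exp2r //; lia.
rewrite [m.+2 ^ m.+1]expnS.
move: (m.+1 ^ m) (m.+2 ^ m) 'C(2 * m, m) 'C((2 * m).+2, m.+1) IH => x y c c' IH xy ec.
rewrite -(@leq_pmul2l m.+1) //.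
have -> : m.+1 * (4 * m.+2 * c') = 4 * m.+2 * (m.+1 * c') by ring.
rewrite ec -(@leq_pmul2l m.+1) //.
have -> : m.+1 * (4 * m.+2 * (2 * (2 * m).+1 * c))
  = (m.+2 * (2 * (2 * m).+1)) * (4 * m.+1 * c) by ring.
apply: leq_trans (_ : (m.+2 * (2 * (2 * m).+1)) * (3 * y) <= _).
  by rewrite leq_mul2l (leq_trans IH) ?orbT // leq_mul2l xy orbT.
have -> : m.+1 * (m.+1 * (3 * (m.+2 * y))) = (m.+2 * (m.+1 * m.+1)) * (3 * y) by ring.
by apply: leq_mul => //; apply: leq_mul => //; nia.
Qed.

Lemma leq_binD N s j : 'C(N + s, j.+1) <= 'C(N, j.+1) + s * 'C((N + s).-1, j).
Proof.
elim: s => [|s IH]; first by rewrite addn0 addn0.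
rewrite addnS /= binS mulSn.
have : 'C((N + s).-1, j) <= 'C(N + s, j) by apply: leq_bin2l; apply: leq_pred.
nia.
Qed.

(** Among the j-subsets of a set of size N + s, those meeting s given points form
at most a fraction s j / (N + s). *)
Lemma leq_bin_shift N s j : 'C(N + s, j) * (N + s - s * j) <= 'C(N, j) * (N + s).
Proof.
case: j => [|j]; first by rewrite !bin0; lia.
have := leq_binD N s j; have := mul_bin_diag (N + s) j.
case: s => [|s]; first by rewrite !addn0 mul0n subn0.
rewrite addnS /= => eC leC.
have : (N + s).+1 * 'C((N + s).+1, j.+1) <=
   (N + s).+1 * 'C(N, j.+1) + s.+1 * (j.+1 * 'C((N + s).+1, j.+1)).
  rewrite -eC; apply: leq_trans (_ : (N + s).+1 * ('C(N, j.+1) + s.+1 * 'C(N + s, j)) <= _).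
    by rewrite leq_mul2l leC orbT.
  by rewrite mulnDr [X in _ + X]mulnCA.
nia.
Qed.

(** The first summand accounts for a quarter of the right side and the second for
three quarters. The latter fails for r = 3, where (r+1) 'C(2r, r) exceeds
(r+1)^r. *)
Lemma coefficient_bound m r : 4 <= r <= m ->
  m.+1 ^ r.+1 + 'C(r + m, r) * (m.+1 * 'C(m.+1 + r, m.+1))
    <= r.+1 ^ r * 'C((2 * m).+1, m.+1).
Proof.
case/andP=> r4 rm.
have -> : 'C(m.+1 + r, m.+1) = 'C(m.+1 + r, r).
  by rewrite -bin_sub ?leq_addr // addKn.
have h1 : 4 * m.+1 ^ r.+1 <= r.+1 ^ r * 'C((2 * m).+1, m.+1).
  rewrite -(@leq_pmul2l r.+1) // mulnA [r.+1 * 4]mulnC.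
  apply: leq_trans (leq_mul (bin_odd_central_ge r r4) (leqnn _)) _.
  by rewrite mulnC mulnA -expnS exp_bin_bound.
have h2 : 4 * ('C(r + m, r) * (m.+1 * 'C(m.+1 + r, r)))
    <= 3 * r.+1 ^ r * 'C((2 * m).+1, m.+1).
  apply: leq_trans (leq_mul (bin_even_central_le r r4) (leqnn _)).
  have := prod_bin_bound r m rm; rewrite [m + r]addnC; nia.
rewrite -(@leq_pmul2l 4) //; lia.
Qed.

(** The quotient of 'C(n - (2r-1), k-r) by 'C(n - (r+1), k-r-1) is close to
n / (k-r) for large n; a factor 2 is enough to absorb the error. *)
Lemma bin_ratio_bound n k r : 0 < r < k -> 16 * (r * k) <= n ->
  n * 'C(n - r.+1, k - r.+1) <= 2 * ((k - r) * 'C(n - (2 * r - 1), k - r)).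
Proof.
case/andP=> r0 rk nbig.
have hk : k <= r * k by rewrite leq_pmull.
have hr : r <= r * k by rewrite leq_pmulr //; lia.
have [j ej] : exists j, k - r = j.+1 by exists (k - r).-1; lia.
set N := n - 2 * r.
have -> : n - (2 * r - 1) = N.+1 by rewrite /N; lia.
have -> : k - r.+1 = j by lia.
rewrite ej -mul_bin_diag /=.
have M0 : 0 < n - r.+1 by lia.
rewrite -(leq_pmul2r M0).
have := leq_bin_shift N r.-1 j.
have -> : N + r.-1 = n - r.+1 by rewrite /N; lia.
have : r.-1 * j <= r * k by apply: leq_mul; lia.
move: (r.-1 * j) (r * k) nbig hk hr => s t nbig hk hr st.
move: 'C(n - r.+1, j) 'C(N, j) => x y h.
apply: leq_trans (_ : 2 * N.+1 * (y * (n - r.+1)) <= _); last by rewrite !mulnA.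
apply: leq_trans (_ : 2 * N.+1 * (x * (n - r.+1 - s)) <= _); last first.
  by rewrite leq_mul2l h orbT.
(* Passing to N.+1 and subtracting s each cost at most an eighth, and
   2 * (7/8) ^ 2 >= 1. *)
suff : n * (n - r.+1) <= 2 * N.+1 * (n - r.+1 - s) by nia.
apply: leq_trans (_ : (2 * N.+1) * (n - r.+1 - t) <= _); last first.
  by rewrite leq_mul2l; apply/orP; right; lia.
rewrite /N; nia.
Qed.

(** A consequence of the bound on n that is polynomial in k and r, in the form that
[bin_ratio_bound] needs. *)
Lemma large_ground k r n : 4 <= r < k ->
  2 * r.+1 ^ r * k * 'C(2 * k - 1, k) <= n * 'C(2 * r - 1, r) -> 16 * (r * k) <= n.
Proof.
case: k => [|m]; [lia|]; rewrite ltnS => /andP[r4 rm] hn.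
have eC : 2 * m.+1 - 1 = (2 * m).+1 by lia.
rewrite eC in hn.
have C0 : 0 < 'C(2 * r - 1, r) by rewrite bin_gt0; lia.
have Cmono : 'C(2 * r - 1, r) <= 'C((2 * m).+1, m.+1).
  have := leq_bin_odd_central r.-1 m; rewrite prednK; last lia.
  by rewrite (_ : (2 * r.-1).+1 = 2 * r - 1); [apply; lia | lia].
rewrite -(leq_pmul2r C0); apply: leq_trans hn.
apply: leq_mul => //; rewrite mulnA leq_mul2r /=.
apply: leq_trans (_ : 2 * r.+1 ^ 3 <= _); first by rewrite !expnS expn0; nia.
by rewrite leq_mul2l leq_exp2l //; lia.
Qed.

Lemma loose_families_small k r n : 4 <= r < k ->
  2 * r.+1 ^ r * k * 'C(2 * k - 1, k) <= n * 'C(2 * r - 1, r) ->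
  (k ^ r.+1 + 'C(r + k.-1, r) * (k * 'C(k + r, k))) * 'C(n - r.+1, k - r.+1)
    <= 'C(2 * r - 1, r) * 'C(n - (2 * r - 1), k - r).
Proof.
move=> rk hn; have nbig := large_ground k r n rk hn.
case: k rk hn nbig => [|m]; [lia|]; rewrite ltnS => /andP[r4 rm] hn nbig.
have eC : 2 * m.+1 - 1 = (2 * m).+1 by lia.
rewrite eC in hn.
have ratio := bin_ratio_bound n m.+1 r ltac:(lia) nbig.
have coef := coefficient_bound m r ltac:(lia).
(* With k = m.+1, the factor 2 * k produces the left side of the bound on n, and
   it is recovered at the end from 2 * (k - r). *)
rewrite -(@leq_pmul2l (2 * m.+1)) //.
apply: leq_trans (_ : 2 * r.+1 ^ r * m.+1 * 'C((2 * m).+1, m.+1)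
    * 'C(n - r.+1, m.+1 - r.+1) <= _).
  by have := leq_mul coef (leqnn 'C(n - r.+1, m.+1 - r.+1)); rewrite /=; nia.
apply: leq_trans (leq_mul hn (leqnn _)) _.
rewrite mulnAC mulnC.
apply: leq_trans (leq_mul (leqnn _) ratio) _.
have : m.+1 - r <= m.+1 by exact: leq_subr.
move: (m.+1 - r) => d dm.
rewrite mulnCA [2 * m.+1 * _]mulnCA !mulnA.
nia.
Qed.

(** * Shadow degree and the majority family *)

Lemma leq_shadow_degree n k r (FF : {set {set 'I_n}}) :
  reflect (r <= n /\ {in shadow k FF, forall E, r <= #|link FF E|})
    (r <= shadow_degree k FF).
Proof. by rewrite /shadow_degree -minEnat -leEnat; apply: bigmin_geP. Qed.

Lemma majority_familyE n k r :
  majority_family n k r =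
  [set F : {set 'I_n} | (#|F| == k) && (r <= #|F :&: initial_segment n (2 * r - 1)|)].
Proof. by apply/setP=> F; rewrite !inE. Qed.

Lemma card_initial_segment n m : m <= n -> #|initial_segment n m| = m.
Proof.
move=> mn; have -> : initial_segment n m = [set widen_ord mn i | i in 'I_m].
  apply/setP=> i; rewrite inE; apply/idP/imsetP => [im|[j _ ->]]; last exact: ltn_ord j.
  by exists (Ordinal im) => //; apply: val_inj.
by rewrite card_imset ?card_ord // => i j /(congr1 val) /= /val_inj.
Qed.

Lemma link_extension n (FF : {set {set 'I_n}}) k (E : {set 'I_n}) :
  {in FF, forall F : {set 'I_n}, #|F| = k.+1} -> #|E| = k ->
  #|link FF E| = #|extension FF E|.
Proof.
move=> unif Ek.
suff -> : link FF E = set1 @: extension FF E by rewrite card_imset //; apply: set1_inj.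
apply/setP=> X; apply/imsetP/imsetP=> [[F /setIdP[FF_F EF] ->]|[y]].
  have /eqP/cards1P[y Fy] : #|F :\: E| = 1.
    by rewrite cardsD (setIidPr EF) unif // Ek subSnn.
  have eF : y |: E = F by rewrite -Fy setUC -[X in X :|: _](setIidPr EF) setID.
  exists y => //; rewrite inE eF FF_F andbT.
  by have /setP/(_ y) := Fy; rewrite !inE eqxx => /andP[].
rewrite inE => /andP[yE yFF] ->; exists (y |: E).
  by rewrite inE yFF subsetUr.
apply/setP=> z; rewrite !inE; case: (eqVneq z y) => [->|_] /=; first by rewrite yE.
by rewrite andNb.
Qed.

Lemma intersectingP n (FF : {set {set 'I_n}}) :
  reflect {in FF, forall F, hitting FF F} (intersecting FF).
Proof. by apply: (iffP forall_inP) => h F /h. Qed.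

Lemma exchange_of_degree n k r (FF : {set {set 'I_n}}) :
  0 < k -> {in FF, forall F : {set 'I_n}, #|F| = k} ->
  r <= shadow_degree k FF -> exchange r FF.
Proof.
case: k => // k _ unif /leq_shadow_degree[_ deg] F x FF_F xF.
have Ek : #|F :\ x| = k by have := cardsD1 x F; rewrite xF unif // => -[].
rewrite -(link_extension _ _ k) //; apply: deg; rewrite inE Ek eqxx /=.
by apply/exists_inP; exists F; rewrite ?subD1set.
Qed.

Lemma degree_of_exchange n k r (FF : {set {set 'I_n}}) :
  0 < k -> {in FF, forall F : {set 'I_n}, #|F| = k} -> r <= n ->
  exchange r FF -> r <= shadow_degree k FF.
Proof.
case: k => // k _ unif rn ex; apply/leq_shadow_degree; split=> // E.
rewrite inE => /andP[/eqP /= Ek /exists_inP[F FF_F EF]].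
rewrite (link_extension _ _ k) //.
have /cards1P[x Fx] : #|F :\: E| == 1.
  by rewrite cardsD (setIidPr EF) unif // Ek subSnn.
have xF : x \in F by have /setP/(_ x) := Fx; rewrite !inE eqxx => /andP[].
suff -> : E = F :\ x by apply: ex.
by rewrite -Fx setDDr setDv set0U (setIidPr EF).
Qed.

Lemma majority_intersecting n k r :
  0 < r -> 2 * r - 1 <= n -> intersecting (majority_family n k r).
Proof.
move=> r0 rn; apply/intersectingP=> F; rewrite majority_familyE inE => /andP[_ Fr].
apply/forall_inP=> F'; rewrite inE => /andP[_ F'r].
apply/negP=> /eqP FF'.
have := card_initial_segment n (2 * r - 1) rn.
move: (initial_segment _ _) Fr F'r => S Fr F'r Sr.
have : #|(F :&: S) :|: (F' :&: S)| <= #|S|.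
  by apply: subset_leq_card; rewrite subUset !subsetIr.
rewrite cardsU -setIIl FF' set0I cards0; lia.
Qed.

(** Let S be the initial segment. If F :\ x already has r elements in S, every
element outside it restores it; otherwise it has exactly r - 1 of the 2r - 1
elements of S, and each of the r others restores it. *)
Lemma majority_exchange n k r :
  0 < r -> 2 * r - 1 <= n -> r + k <= n.+1 -> exchange r (majority_family n k r).
Proof.
move=> r0 rn rkn F x; rewrite majority_familyE inE => /andP[/eqP Fk Fr] xF.
have := card_initial_segment n (2 * r - 1) rn.
move: (initial_segment _ _) Fr => S Fr Sr.
have cE : #|F :\ x| = k.-1 by have := cardsD1 x F; rewrite xF Fk => ->.
have k0 : 0 < k by rewrite -Fk card_gt0; apply/set0Pn; exists x.
have inext y : y \notin F :\ x -> r <= #|(y |: F :\ x) :&: S| ->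
    y \in extension [set F : {set 'I_n} | (#|F| == k) & (r <= #|F :&: S|)] (F :\ x).
  by move=> yE yr; rewrite inE yE inE yr cardsU1 yE cE add1n prednK // eqxx.
have Er : r.-1 <= #|(F :\ x) :&: S|.
  have := cardsD1 x (F :&: S); rewrite setIDAC; lia.
have [big|small] := leqP r #|(F :\ x) :&: S|.
  apply: leq_trans (_ : #|~: (F :\ x)| <= _).
    have := cardsC (F :\ x); rewrite cE card_ord; lia.
  apply: subset_leq_card; apply/subsetP=> y; rewrite inE => yE.
  apply: inext => //; apply: leq_trans big _.
  by apply: subset_leq_card; apply: setSI; apply: subsetUr.
apply: leq_trans (_ : #|S :\: (F :\ x)| <= _).
  by have := cardsID (F :\ x) S; rewrite [S :&: _]setIC; lia.
apply: subset_leq_card; apply/subsetP=> y /setDP[yS yE].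
apply: inext => //; rewrite setIUl.
have -> : [set y] :&: S = [set y] by apply/setIidPl; rewrite sub1set.
by rewrite cardsU1 in_setI (negbTE yE) /= add1n -(prednK r0) ltnS.
Qed.

(** The dichotomy on traces: either some trace on the kernel has size r, or all
of them are larger. *)
Lemma intersecting_family_bound n k r (FF : {set {set 'I_n}}) :
  0 < r < k -> 2 * r - 1 <= n -> FF \subset uniform_sets n k ->
  intersecting FF -> r <= shadow_degree k FF ->
  #|FF| <= #|majority_family n k r| \/
  #|FF| <= (k ^ r.+1 + 'C(r + k.-1, r) * (k * 'C(k + r, k))) * 'C(n - r.+1, k - r.+1).
Proof.
case/andP=> r0 rk rn /subsetP unifS /intersectingP int deg.
have unif : {in FF, forall F : {set 'I_n}, #|F| = k}.
  by move=> F /unifS; rewrite inE => /eqP.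
have ex := exchange_of_degree n k r FF (leq_trans r0 (ltnW rk)) unif deg.
have [->|FF0] := eqVneq FF set0; first by left; rewrite cards0.
have tau D : hitting FF D -> r <= #|D| by apply: hitting_size.
have [V [cV kerV]] := kernel k r FF unif int.
have [noB|yesB] := eqVneq (tight_traces r FF V) set0.
  right; have big : {in FF, forall F, r < #|F :&: V|}.
    move=> F FF_F; rewrite ltnNge; apply/negP=> small.
    have eqr : #|F :&: V| = r.
      by apply/eqP; rewrite eqn_leq small tau // kerV.
    have : F :&: V \in tight_traces r FF V.
      by apply/imsetP; exists F => //; rewrite inE FF_F eqr eqxx.
    by rewrite noB inE.
  have := card_no_tight_trace k r FF V unif int tau big; rewrite card_ord.
  move/leq_trans; apply; rewrite leq_mul2r leq_add2l; apply/orP; right.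
  by apply: leq_mul => //; apply: card_tight_hitting_sets.
left; have [S Sr FS] := tight_traces_complete r FF V ex kerV yesB.
rewrite majority_familyE; apply: leq_trans (card_heavy_sets k r S _ _); last first.
  by rewrite card_initial_segment // Sr subn1.
apply: subset_leq_card; apply/subsetP=> F FF_F.
by rewrite inE unif // eqxx FS.
Qed.

Theorem theorem1p6 (k r n : nat)
  (hr : (4 <= r <= k - 1)%N)
  (hn : (2 * (r%:R + 1) ^+ r * k%:R *
           ('C(2 * k - 1, k)%:R / 'C(2 * r - 1, r)%:R) <= n%:R :> rat)%R) :
  max_intersecting n k r = #|majority_family n k r|.
Proof.
have r4k : 4 <= r < k by lia.
have {}hn : 2 * r.+1 ^ r * k * 'C(2 * k - 1, k) <= n * 'C(2 * r - 1, r).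
  have C0 : (0 < 'C(2 * r - 1, r)%:R :> rat)%R by rewrite ltr0n bin_gt0; lia.
  move: hn; rewrite mulrA ler_pdivrMr // => hn.
  by rewrite -(ler_nat rat) !natrM natrX -(natr1 r).
have nbig := large_ground k r n r4k hn.
have [r4 rk] : 4 <= r /\ r < k by lia.
have rkk : k <= r * k by rewrite leq_pmull //; lia.
have rn : 2 * r - 1 <= n by lia.
have unifL : {in majority_family n k r, forall F : {set 'I_n}, #|F| = k}.
  by move=> F; rewrite majority_familyE inE => /andP[/eqP].
apply/eqP; rewrite eqn_leq; apply/andP; split.
  apply/bigmax_leqP=> FF /and3P[unif int deg].
  have [//|small] := intersecting_family_bound n k r FF ltac:(lia) rn unif int deg.
  apply: leq_trans small _; apply: leq_trans (loose_families_small k r n r4k hn) _.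
  have := card_heavy_sets_ge k r (initial_segment n (2 * r - 1)) (ltnW rk).
  by rewrite majority_familyE card_initial_segment // card_ord.
apply: (@leq_bigmax_cond _ _ (fun FF : {set {set 'I_n}} => #|FF|)).
rewrite majority_intersecting; [|lia|done]; apply/andP; split; last first.
  apply: degree_of_exchange => //; [lia | lia | apply: majority_exchange; lia].
by apply/subsetP=> F /unifL Fk; rewrite inE Fk.
Qed.
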